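(* Let $\nu$ be a symmetric L\'evy measure on $\mathbb{R}^n$, let $\Omega\subseteq\mathbb{R}^n$ be nonempty, open and bounded, $f\in L^2(\Omega)$, and $g:\Omega^c\to\mathbb{R}$. If $u\in C_b^2(\mathbb{R}^n)$ is a solution of $$\begin{cases}Lu=f&\text{in }\Omega,\\ u=g&\text{in }\mathbb{R}^n\setminus\Omega,\end{cases}$$ i.e. both equations hold almost everywhere, then $u$ is also a weak solution of this problem.
   Context: All functions are real-valued; $\Omega^c=\mathbb{R}^n\setminus\Omega$. A symmetric L\'evy measure is a nonnegative Borel measure $\nu$ on $\mathbb{R}^n$ with $\nu(\{0\})=0$, $\nu(-A)=\nu(A)$ for every Borel $A$, and $\int_{\mathbb{R}^n}(1\wedge|y|^2)\,d\nu(y)<\infty$. For $x\in\mathbb{R}^n$, $\nu_x(A)=\nu(A-x)$. The operator $L$ is $$Lu(x)=\lim_{\varepsilon\to0^+}\int_{\mathbb{R}^n\setminus B(0,\varepsilon)}(u(x)-u(x+y))\,d\nu(y).$$ $C_b^2(\mathbb{R}^n)$ is the space of $C^2$ functions whose derivatives of order $0,1,2$ are bounded. $V_\nu^\Omega(\mathbb{R}^n)$ is the space of Borel measurable $u$ on $\mathbb{R}^n$ (identified if equal a.e.) with $\|u\|_{L^2(\Omega)}^2+\frac12\int_\Omega\int_{\mathbb{R}^n}(u(x)-u(y))^2\,d\nu_y(x)\,dy<\infty$, and $H_\nu^\Omega(\mathbb{R}^n)=\{u\in V_\nu^\Omega(\mathbb{R}^n):u=0\text{ a.e. in }\Omega^c\}$.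 A function $u$ is a weak solution of the Dirichlet problem $Lu=f$ in $\Omega$, $u=g$ in $\mathbb{R}^n\setminus\Omega$, if $u\in V_\nu^\Omega(\mathbb{R}^n)$, $u=g$ a.e. in $\Omega^c$, and $$\frac12\int_{\mathbb{R}^n}\int_{\mathbb{R}^n}(u(x)-u(y))(\phi(x)-\phi(y))\,d\nu_y(x)\,dy=\int_\Omega f\phi\,dx\qquad\text{for every }\phi\in H_\nu^\Omega(\mathbb{R}^n).$$ *)

(* Defs.v *)
From HB Require Import structures.
From mathcomp Require Import all_boot all_order all_algebra.
From mathcomp Require Import all_classical all_reals all_analysis.
From mathcomp Require Import measurable_realfun.

Set Implicit Arguments.
Unset Strict Implicit.
Unset Printing Implicit Defensive.

Import Order.TTheory GRing.Theory Num.Theory.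
Import numFieldTopology.Exports numFieldNormedType.Exports.

Local Open Scope classical_set_scope.
Local Open Scope ring_scope.

(* R^n is 'rV[R]_n with its Borel sigma-algebra. *)
HB.instance Definition _ (R : realType) (m n : nat) :=
  @isMeasurable.Build (sigma_display (@open 'M[R]_(m, n))) 'M[R]_(m, n)
    <<s @open 'M[R]_(m, n) >> (@sigma_algebra0 _ _ _) (@sigma_algebraC _ _)
    (@sigma_algebra_bigcup _ _ _).

Lemma open_measurable_mx (R : realType) (m n : nat) (U : set 'M[R]_(m, n)) :
  open U -> measurable U.
Proof. by move=> oU; exact: sub_sigma_algebra. Qed.

Lemma continuous_measurable_mx (R : realType) (m n : nat)
    (f : 'M[R]_(m, n) -> R) :
  continuous f -> measurable_fun setT f.
Proof.
move=> /continuousP cf; apply: (measurability _ (RGenOpens.measurableE R)).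
move=> _ [_ [a [b ->] <-]]; rewrite setTI; apply: open_measurable_mx.
by apply: cf; exact: interval_open.
Qed.

Lemma measurable_fun_rV (R : realType) (n : nat) (d : measure_display)
    (T : measurableType d) (f : T -> 'rV[R]_n) :
  (forall i, measurable_fun setT (fun t => f t ord0 i)) -> measurable_fun setT f.
Proof.
move=> mf.
have mball (q : 'rV[R]_n) (e : R) : 0 < e -> measurable (f @^-1` ball q e).
  move=> e0.
  have -> : f @^-1` ball q e =
      \bigcap_(i in [set: 'I_n]) ((fun t => f t ord0 i) @^-1` ball (q ord0 i) e).
    apply/seteqP; split=> [t [_ h] i _ /=|t h]; first exact: h.
    by split=> // i j; rewrite ord1; exact: (h j).
  apply: fin_bigcap_measurable => // i _.
  rewrite -[X in measurable X]setTI; apply: mf => //.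
  by apply: open_measurable; exact: ball_open.
apply: (@measurability _ _ _ _ setT f (@open 'rV[R]_n)) => //.
move=> _ [U oU <-]; rewrite setTI.
pose q (p : 'rV[rat]_n) : 'rV[R]_n := map_mx ratr p.
pose F (p : 'rV[rat]_n * nat) :=
  if pselect (ball (q p.1) p.2.+1%:R^-1 `<=` U)
  then f @^-1` ball (q p.1) p.2.+1%:R^-1 else set0.
have -> : f @^-1` U = \bigcup_p F p.
  apply/seteqP; split=> [t Uft|t [p _]]; last first.
    by rewrite /F; case: pselect => // h; exact: h.
  have /nbhs_ballP[e e0 eU] : nbhs (f t) U by exact: open_nbhs_nbhs.
  have [k hk] : exists k : nat, k.+1%:R^-1 < e / 2.
    have := near_infty_natSinv_lt (PosNum (divr_gt0 e0 (ltr0n R 2))).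
    by move=> [k _ /(_ k (leqnn k))] /= ?; exists k.
  have k0 : (0 : R) < k.+1%:R^-1 by rewrite invr_gt0.
  have hq (i : 'I_n) : {p : rat | `|ratr p - f t ord0 i| < k.+1%:R^-1}.
    apply: cid.
    have /rat_in_itvoo[p] :
      f t ord0 i - k.+1%:R^-1 < f t ord0 i + k.+1%:R^-1.
      by rewrite ltrBlDr -addrA ltrDl addr_gt0.
    by rewrite in_itv/= -ltr_distl => ?; exists p.
  pose p : 'rV[rat]_n := \row_i projT1 (hq i).
  have qf : ball (q p) k.+1%:R^-1 (f t).
    split=> // i j; rewrite ord1 !mxE; case: (hq j) => x /= hx.
    by rewrite /ball/=.
  exists (p, k) => //; rewrite /F /=; case: pselect => // h; exfalso; apply: h.
  move=> y qy; apply: eU; rewrite [e]splitr.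
  apply: (@ball_triangle _ _ (q p)); apply: (le_ball (ltW hk)) => //.
  exact: ball_sym.
apply: countable_bigcupT_measurable => // p; rewrite /F.
case: pselect => h; last exact: measurable0.
by apply: mball; rewrite invr_gt0.
Qed.

Lemma measurable_coord (R : realType) (n : nat) (i : 'I_n) :
  measurable_fun setT (fun v : 'rV[R]_n => v ord0 i).
Proof. by apply: continuous_measurable_mx; exact: coord_continuous. Qed.

Definition cons_rV (R : realType) (n : nat) (p : measurableTypeR R * 'rV[R]_n) :
    'rV[R]_n.+1 :=
  \row_i if unlift ord0 i is Some j then p.2 ord0 j else (p.1 : R).

Lemma cons_rV0 (R : realType) (n : nat) (p : measurableTypeR R * 'rV[R]_n) :
  cons_rV p ord0 ord0 = p.1.
Proof. by rewrite mxE unlift_none. Qed.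

Lemma cons_rVS (R : realType) (n : nat) (p : measurableTypeR R * 'rV[R]_n)
    (i : 'I_n) :
  cons_rV p ord0 (lift ord0 i) = p.2 ord0 i.
Proof. by rewrite mxE liftK. Qed.

Lemma measurable_cons_rV (R : realType) (n : nat) :
  measurable_fun setT (@cons_rV R n).
Proof.
apply: measurable_fun_rV => i; case: (unliftP ord0 i) => [j|] ->.
  under eq_fun do rewrite cons_rVS.
  exact: (measurableT_comp (measurable_coord j) measurable_snd).
under eq_fun do rewrite cons_rV0.
exact: measurable_fst.
Qed.

Definition lebesgue_cons (R : realType) (n : nat)
    (m : {sigma_finite_measure set 'rV[R]_n -> \bar R}) :
  set 'rV[R]_n.+1 -> \bar R :=
  pushforward (@lebesgue_measure R \x m)%E (@cons_rV R n).

Section lebesgue_cons_measure.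
Variables (R : realType) (n : nat).
Variable m : {sigma_finite_measure set 'rV[R]_n -> \bar R}.

Let mcons : measurable_fun setT (@cons_rV R n) := @measurable_cons_rV R n.

Let lebesgue_cons0 : lebesgue_cons m set0 = 0%E.
Proof. exact: measure0. Qed.

Let lebesgue_cons_ge0 A : (0 <= lebesgue_cons m A)%E.
Proof. exact: measure_ge0. Qed.

Let lebesgue_cons_sigma_additive : semi_sigma_additive (lebesgue_cons m).
Proof. exact: measure_semi_sigma_additive. Qed.

HB.instance Definition _ := isMeasure.Build _ _ _ (lebesgue_cons m)
  lebesgue_cons0 lebesgue_cons_ge0 lebesgue_cons_sigma_additive.

Let sigma_finite_lebesgue_cons : sigma_finite setT (lebesgue_cons m).
Proof.
have /sigma_finiteP[A [TA ndA Aoo]] := sigma_finiteT (@lebesgue_measure R).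
have /sigma_finiteP[B [TB ndB Boo]] := sigma_finiteT m.
pose h (v : 'rV[R]_n.+1) : measurableTypeR R * 'rV[R]_n :=
  (v ord0 ord0, \row_i v ord0 (lift ord0 i)).
have mh : measurable_fun setT h.
  apply: measurable_fun_pair; first exact: measurable_coord.
  apply: measurable_fun_rV => i; under eq_fun do rewrite mxE.
  exact: measurable_coord.
exists (fun k => h @^-1` (A k `*` B k)).
  apply/esym; rewrite -preimage_bigcup -subTset => v _ /=.
  have [i _ Ai] : (\bigcup_i A i) (h v).1 by rewrite -TA.
  have [j _ Bj] : (\bigcup_i B i) (h v).2 by rewrite -TB.
  exists (maxn i j) => //; split.
    by move: Ai; exact/subsetPset/ndA/leq_maxl.
  by move: Bj; exact/subsetPset/ndB/leq_maxr.
move=> k; have [mA Alt] := Aoo k; have [mB Blt] := Boo k; split.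
  by rewrite -[X in measurable X]setTI; apply: mh => //; exact: measurableX.
rewrite /lebesgue_cons /pushforward -comp_preimage.
suff -> : h \o @cons_rV R n = id.
  by rewrite preimage_id product_measure1E// lte_mul_pinfty// ge0_fin_numE.
apply/funext => -[x v]; rewrite /h /= cons_rV0; congr (_, _).
by apply/rowP => i; rewrite mxE cons_rVS.
Qed.

HB.instance Definition _ := Measure_isSigmaFinite.Build _ _ _ (lebesgue_cons m)
  sigma_finite_lebesgue_cons.

End lebesgue_cons_measure.

(* n-fold product of the Lebesgue measure of R, the first coordinate being the
   outermost factor; lebesgue_rV_box characterizes it. *)
Fixpoint lebesgue_rV (R : realType) (n : nat) :
    {sigma_finite_measure set 'rV[R]_n -> \bar R} :=
  match n with
  | 0 => \d_(0 : 'rV[R]_0)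
  | n.+1 => lebesgue_cons (lebesgue_rV R n)
  end.

Lemma lebesgue_rV_box (R : realType) (n : nat) (a b : 'rV[R]_n) :
  (forall i, a ord0 i <= b ord0 i) ->
  lebesgue_rV R n [set v | forall i, a ord0 i <= v ord0 i <= b ord0 i] =
  (\prod_(i < n) (b ord0 i - a ord0 i))%:E.
Proof.
elim: n a b => [|n IHn] a b ab.
  by rewrite /= diracE big_ord0 mem_set// => -[].
pose tl (v : 'rV[R]_n.+1) : 'rV[R]_n := \row_i v ord0 (lift ord0 i).
pose B : set 'rV[R]_n :=
  [set v : 'rV[R]_n | forall i, tl a ord0 i <= v ord0 i <= tl b ord0 i].
pose I : set (measurableTypeR R) := `[a ord0 ord0, b ord0 ord0]%classic.
rewrite /= /lebesgue_cons /pushforward.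
set X := (X in product_measure1 _ _ X).
have -> : X = I `*` B.
  apply/seteqP; split=> [[x v] h|[x v] [/= hx hv] i].
    split=> [|i]; first by have := h ord0; rewrite cons_rV0 /I /= in_itv.
    by have := h (lift ord0 i); rewrite cons_rVS !mxE.
  case: (unliftP ord0 i) => [j|] ->.
    by have := hv j; rewrite cons_rVS !mxE.
  by move: hx; rewrite cons_rV0 /I /= in_itv.
have mB : measurable B.
  have -> : B = \bigcap_(i in [set: 'I_n])
      ((fun v : 'rV[R]_n => v ord0 i) @^-1` `[tl a ord0 i, tl b ord0 i]).
    apply/seteqP; split=> v h i; first by move=> _; rewrite /= in_itv/=; exact: h.
    by have := h i Logic.I; rewrite /= in_itv.
  apply: fin_bigcap_measurable => // i _.
  by rewrite -[X in measurable X]setTI; exact: measurable_coord.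
rewrite product_measure1E //; last exact: measurable_itv.
rewrite IHn; last by move=> i; rewrite !mxE.
have := lebesgue_measure_itv `[a ord0 ord0, b ord0 ord0]; rewrite /= -/I => ->.
rewrite lte_fin big_ord_recl /=.
under eq_bigr do rewrite !mxE.
have := ab ord0; rewrite le_eqVlt => /orP[/eqP ->|->]; last by rewrite -EFinB.
by rewrite ltxx subrr mul0e mul0r.
Qed.

(* The library norm of 'rV[R]_n is the sup norm. *)
Definition enorm (R : realType) (n : nat) (x : 'rV[R]_n) : R :=
  Num.sqrt (\sum_(i < n) x ord0 i ^+ 2).

Definition eball0 (R : realType) (n : nat) (r : R) : set 'rV[R]_n :=
  [set y | enorm y < r].

Definition symmetric_levy_measure (R : realType) (n : nat)
    (nu : {measure set 'rV[R]_n -> \bar R}) : Prop :=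
  [/\ nu [set 0] = 0%E,
      forall A : set 'rV[R]_n, measurable A -> nu [set - y | y in A] = nu A &
      (\int[nu]_y (Num.min 1 (enorm y ^+ 2))%:E < +oo)%E].

(* nu_x, in the form to which change of variables applies; see translateE. *)
Definition translate (R : realType) (n : nat)
    (nu : {measure set 'rV[R]_n -> \bar R}) (x : 'rV[R]_n) :
    set 'rV[R]_n -> \bar R :=
  pushforward nu (fun y => y + x).

Lemma measurable_addr_rV (R : realType) (n : nat) (x : 'rV[R]_n) :
  measurable_fun setT (fun y : 'rV[R]_n => y + x).
Proof.
apply: measurable_fun_rV => i; under eq_fun do rewrite mxE.
by apply: measurable_funD => //; exact: measurable_coord.
Qed.

Section translate_measure.
Variables (R : realType) (n : nat).
Variables (nu : {measure set 'rV[R]_n -> \bar R}) (x : 'rV[R]_n).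

Let madd : measurable_fun setT (fun y : 'rV[R]_n => y + x) :=
  measurable_addr_rV x.

Let translate0 : translate nu x set0 = 0%E.
Proof. exact: measure0. Qed.

Let translate_ge0 A : (0 <= translate nu x A)%E.
Proof. exact: measure_ge0. Qed.

Let translate_sigma_additive : semi_sigma_additive (translate nu x).
Proof. exact: measure_semi_sigma_additive. Qed.

HB.instance Definition _ := isMeasure.Build _ _ _ (translate nu x)
  translate0 translate_ge0 translate_sigma_additive.

End translate_measure.

Lemma translateE (R : realType) (n : nat)
    (nu : {measure set 'rV[R]_n -> \bar R}) (x : 'rV[R]_n) (A : set 'rV[R]_n) :
  translate nu x A = nu [set a - x | a in A].
Proof.
rewrite /translate /pushforward; congr (nu _); apply/seteqP; split=> [y Ay|_ [a Aa <-]].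
  by exists (y + x) => //; rewrite addrK.
by rewrite /= subrK.
Qed.

Definition levy_truncated (R : realType) (n : nat)
    (nu : {measure set 'rV[R]_n -> \bar R}) (u : 'rV[R]_n -> R)
    (x : 'rV[R]_n) (e : R) : \bar R :=
  (\int[nu]_(y in ~` eball0 e) (u x - u (x + y))%:E)%E.

Definition levy_op (R : realType) (n : nat)
    (nu : {measure set 'rV[R]_n -> \bar R}) (u : 'rV[R]_n -> R)
    (x : 'rV[R]_n) : \bar R :=
  lim (levy_truncated nu u x e @[e --> 0^'+]).

(* "Lu(x) = c": the limit exists and equals c (lim alone is a junk value when
   there is no limit). *)
Definition levy_op_eq (R : realType) (n : nat)
    (nu : {measure set 'rV[R]_n -> \bar R}) (u : 'rV[R]_n -> R)
    (x : 'rV[R]_n) (c : R) : Prop :=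
  cvg (levy_truncated nu u x e @[e --> 0^'+]) /\ levy_op nu u x = c%:E.

Definition partial (R : realType) (n : nat) (i : 'I_n) (u : 'rV[R]_n -> R) :
    'rV[R]_n -> R :=
  fun x => 'D_(delta_mx ord0 i) u x.

(* C^k functions on R^n all of whose partial derivatives of order <= k are
   bounded *)
Fixpoint Cb (R : realType) (n : nat) (k : nat) (u : 'rV[R]_n -> R) : Prop :=
  [/\ continuous u, bounded_fun u &
      if k is k'.+1 then
        forall i : 'I_n, (forall x, derivable u x (delta_mx ord0 i)) /\
                         Cb k' (partial i u)
      else True].

(* f is total, but only its values on Omega matter. *)
Definition L2_on (R : realType) (n : nat) (Omega : set 'rV[R]_n)
    (f : 'rV[R]_n -> R) : Prop :=
  measurable_fun Omega f /\
  (\int[lebesgue_rV R n]_(x in Omega) (f x ^+ 2)%:E < +oo)%E.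

(* Integrals are extended-real valued. Functions are Borel representatives of
   their a.e. classes. *)
Definition V_space (R : realType) (n : nat)
    (nu : {measure set 'rV[R]_n -> \bar R}) (Omega : set 'rV[R]_n)
    (u : 'rV[R]_n -> R) : Prop :=
  measurable_fun setT u /\
  (\int[lebesgue_rV R n]_(x in Omega) (u x ^+ 2)%:E +
   (2^-1)%:E * \int[lebesgue_rV R n]_(y in Omega)
     \int[translate nu y]_x ((u x - u y) ^+ 2)%:E < +oo)%E.

Definition H_space (R : realType) (n : nat)
    (nu : {measure set 'rV[R]_n -> \bar R}) (Omega : set 'rV[R]_n)
    (u : 'rV[R]_n -> R) : Prop :=
  V_space nu Omega u /\ {ae lebesgue_rV R n, forall x, ~ Omega x -> u x = 0}.

(* Only the values of f on Omega and of g off Omega are used. *)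
Definition ae_solution (R : realType) (n : nat)
    (nu : {measure set 'rV[R]_n -> \bar R}) (Omega : set 'rV[R]_n)
    (f g u : 'rV[R]_n -> R) : Prop :=
  {ae lebesgue_rV R n, forall x, Omega x -> levy_op_eq nu u x (f x)} /\
  {ae lebesgue_rV R n, forall x, ~ Omega x -> u x = g x}.

Definition weak_solution (R : realType) (n : nat)
    (nu : {measure set 'rV[R]_n -> \bar R}) (Omega : set 'rV[R]_n)
    (f g u : 'rV[R]_n -> R) : Prop :=
  [/\ V_space nu Omega u,
      {ae lebesgue_rV R n, forall x, ~ Omega x -> u x = g x} &
      forall phi : 'rV[R]_n -> R, H_space nu Omega phi ->
        ((2^-1)%:E * \int[lebesgue_rV R n]_y \int[translate nu y]_x
           ((u x - u y) * (phi x - phi y))%:E =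
         \int[lebesgue_rV R n]_(x in Omega) (f x * phi x)%:E)%E].

(* Main.v *)
From HB Require Import structures.
Require Import Defs.
From mathcomp Require Import all_boot all_order all_algebra.
From mathcomp Require Import all_classical all_reals all_analysis.
From mathcomp Require Import measurable_realfun ring lra.

Set Implicit Arguments.
Unset Strict Implicit.
Unset Printing Implicit Defensive.

Import Order.TTheory GRing.Theory Num.Theory.
Import numFieldTopology.Exports numFieldNormedType.Exports.

Local Open Scope classical_set_scope.
Local Open Scope ring_scope.

(** Write [D w (y, z) = w (y + z) - w y] and let [P] be the product of the
    Lebesgue measure (in the base point [y]) and [nu] (in the jump [z]). After
    the change of variables [x = y + z] in the inner integral, the bilinear form
    is one half of the [P]-integral of [D u * D phi], and the theorem is a
    discrete integration by parts for this integral.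

    Its source is the involution [flip : (y, z) |-> (y + z, - z)], which
    exchanges the two ends of a jump. It preserves [P], because [nu] is
    symmetric and the Lebesgue measure is translation invariant
    ([flip_invariant]), and it changes the sign of increments. Suppose for a
    moment that [nu] is finite. Then [D u * D phi] splits into [- D u * phi y]
    and its image under [flip], so one half of its integral is the integral of
    [- D u * phi y], which is the integral of [phi * L u] by Fubini.

    A general [nu] is reached by keeping only the jumps [|z| >= 1 / (k + 1)], on
    which [nu] is finite, and letting [k] tend to infinity by dominated
    convergence on both sides.

    On the side of the form, [D u * D phi] has to be [P]-integrable
    ([integrable_form]). It vanishes unless [phi] is nonzero at one end of the
    jump; up to a null set this puts that end in [Omega], and [flip] allows one
    to assume that it is the starting end. There the product is at most
    [(D u) ^ 2 + (D phi) ^ 2], whose integral is finite because [u] and [phi]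
    have finite energy over [Omega].

    On the side of the operator, the truncations of [L u] converge to [f] almost
    everywhere in [Omega], and they are bounded uniformly in [k] and in the base
    point ([levy_truncated_bound]): by the symmetry of [nu] they are half the
    integrals of second differences of [u], which are of order
    [min (1, |z| ^ 2)] since [u] is of class C^2 with bounded derivatives. As
    [phi] is integrable over the bounded set [Omega], a multiple of [|phi|]
    dominates. *)

(** * Increments of functions with bounded partial derivatives *)

Lemma bounded_fun_norm (R : realType) (T : Type) (f : T -> R) :
  bounded_fun f -> exists2 M, 0 <= M & forall x, `|f x| <= M.
Proof.
move=> /pinfty_ex_gt0[M M0 h]; exists M; first exact: ltW.
by move=> x; exact: h.
Qed.

Section coordinate_mean_value.
Context {R : realType}.

(** The sign of [a] is arbitrary: coordinates of jumps may be negative. *)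
Lemma mean_value_origin (h dh : R -> R) (a : R) :
  (forall t : R, is_derive t 1 h (dh t)) ->
  exists2 c, `|c| <= `|a| & h a - h 0 = a * dh c.
Proof.
move=> hd.
have hc : continuous h.
  move=> t; apply/differentiable_continuous/derivable1_diffP.
  by have [] := hd t.
have [a0|/ltW a0] := leP 0 a.
  have [c] := MVT_segment a0 (fun t _ => hd t) (continuous_subspaceT hc).
  rewrite in_itv/= subr0 => /andP[c0 ca] ->; exists c; last by rewrite mulrC.
  by rewrite !ger0_norm.
have [c] := MVT_segment a0 (fun t _ => hd t) (continuous_subspaceT hc).
rewrite in_itv/= sub0r => /andP[ac c0] E; exists c.
  by rewrite !ler0_norm// lerN2.
by rewrite -opprB E mulrN opprK mulrC.
Qed.

Lemma is_derive_line (n : nat) (u : 'rV[R]_n -> R) (x v : 'rV[R]_n) (t : R) :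
  derivable u (x + t *: v) v ->
  is_derive t 1 (fun s => u (x + s *: v)) ('D_v u (x + t *: v)).
Proof.
have E : (fun h : R =>
      h^-1 *: (u (x + (h *: (1 : R) + t) *: v) - u (x + t *: v))) =
    (fun h : R => h^-1 *: (u (h *: v + (x + t *: v)) - u (x + t *: v))).
  apply/funext => h; congr (_ *: (u _ - _)).
  by rewrite scalerDl /= [h *: 1]mulr1 addrCA.
move=> du; apply: DeriveDef; first by rewrite /derivable /= E; exact: du.
by rewrite /derive /= E.
Qed.

Variable n : nat.
Implicit Types (u : 'rV[R]_n -> R) (x y : 'rV[R]_n).

(** The path [y + head_rV k x], [k = 0 .. n], goes from [y] to [y + x] by moving
    one coordinate at a time. *)
Definition head_rV (k : nat) x : 'rV[R]_n :=
  \row_j if (j < k)%N then x ord0 j else 0.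

Lemma head_rVS (i : 'I_n) x :
  head_rV i.+1 x = head_rV i x + x ord0 i *: delta_mx ord0 i.
Proof.
apply/rowP => j; rewrite !mxE eqxx /= ltnS leq_eqVlt.
have [ij|ij] := eqVneq (j : nat) i.
  by have -> : j = i by [exact: val_inj]; rewrite ltnn eqxx mulr1 add0r.
have /negPf -> : j != i by apply: contra ij => /eqP ->.
by rewrite mulr0 addr0.
Qed.

(** The hypothesis controls [u] along the axes only, so the increment is
    telescoped along an axis-parallel path, with one intermediate point for each
    coordinate. That these points stay close to [y] is what [second_difference]
    needs. *)
Lemma mean_value_rV u x y :
  (forall i z, derivable u z (delta_mx ord0 i)) ->
  exists2 xi : 'I_n -> 'rV[R]_n,
    (forall i j, `|xi i ord0 j - y ord0 j| <= `|x ord0 j|) &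
    u (y + x) - u y = \sum_i x ord0 i * partial i u (xi i).
Proof.
move=> du.
have step (i : 'I_n) : exists z : 'rV[R]_n,
    (forall j, `|z ord0 j - y ord0 j| <= `|x ord0 j|) /\
    u (y + head_rV i.+1 x) - u (y + head_rV i x) = x ord0 i * partial i u z.
  have [c ca E] := mean_value_origin (x ord0 i) (fun t =>
    is_derive_line (du i ((y + head_rV i x) + t *: delta_mx ord0 i))).
  exists ((y + head_rV i x) + c *: delta_mx ord0 i); split; last first.
    by rewrite head_rVS addrA -E scale0r addr0.
  move=> j; rewrite !mxE eqxx /=.
  have -> : forall a b d : R, a + b + d - a = b + d by move=> a b d; ring.
  have [-> |ij] := eqVneq j i; first by rewrite ltnn mulr1 add0r.
  by rewrite mulr0 addr0; case: ifP => // _; rewrite normr0.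
have [xi xiP] := choice step; exists xi; first by move=> i; have [] := xiP i.
have -> : \sum_i x ord0 i * partial i u (xi i) =
    \sum_(i < n) (u (y + head_rV i.+1 x) - u (y + head_rV i x)).
  by apply: eq_bigr => i _; have [_ ->] := xiP i.
rewrite -(big_mkord xpredT
  (fun i => u (y + head_rV i.+1 x) - u (y + head_rV i x))).
rewrite (telescope_sumr (fun i => u (y + head_rV i x)))//; congr (u _ - u _).
  by congr (_ + _); apply/rowP => j; rewrite mxE ltn_ord.
by rewrite -[LHS]addr0; congr (_ + _); apply/rowP => j; rewrite !mxE.
Qed.

Lemma lipschitz_partial u (M : R) :
  (forall i z, derivable u z (delta_mx ord0 i)) ->
  (forall i z, `|partial i u z| <= M) ->
  forall y z, `|u y - u z| <= M * \sum_j `|y ord0 j - z ord0 j|.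
Proof.
move=> du uM y z; have [xi _] := mean_value_rV (y - z) z du.
rewrite subrKC => ->; rewrite (le_trans (ler_norm_sum _ _ _))// mulr_sumr.
by apply: ler_sum => i _; rewrite normrM !mxE mulrC ler_wpM2r.
Qed.

(** Each of the two first differences is a sum of partial derivatives at points
    close to [y]; the first-order terms cancel, and the partial derivatives at
    the two families of points differ by a Lipschitz estimate. *)
Lemma second_difference u (M : R) :
  (forall i z, derivable u z (delta_mx ord0 i)) ->
  (forall i j z, derivable (partial i u) z (delta_mx ord0 j)) ->
  (forall i j z, `|partial j (partial i u) z| <= M) ->
  forall y x, `|u y - u (y + x) + (u y - u (y - x))| <=
    2 * M * (\sum_j `|x ord0 j|) ^+ 2.
Proof.
move=> du ddu uM y x.
have [a aP aE] := mean_value_rV x y du.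
have [b bP bE] := mean_value_rV (- x) y du.
have -> : u y - u (y + x) + (u y - u (y - x)) =
    - \sum_i x ord0 i * (partial i u (a i) - partial i u (b i)).
  have -> : \sum_i x ord0 i * (partial i u (a i) - partial i u (b i)) =
     (u (y + x) - u y) + (u (y - x) - u y).
    rewrite aE bE -big_split /=; apply: eq_bigr => i _.
    by rewrite mulrBr mxE mulNr.
  ring.
rewrite normrN (le_trans (ler_norm_sum _ _ _))// expr2 mulrA mulr_sumr.
apply: ler_sum => i _; rewrite normrM mulrC ler_wpM2r//.
rewrite (le_trans (lipschitz_partial (ddu i) (uM i) _ _))// [2 * M]mulrC -mulrA.
have M0 : 0 <= M by apply: le_trans (uM i i 0).
rewrite ler_wpM2l// mulr_sumr; apply: ler_sum => j _.
have /(_ i j) := aP; have /(_ i j) := bP; rewrite mxE normrN => hb ha.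
have -> : a i ord0 j - b i ord0 j =
  (a i ord0 j - y ord0 j) - (b i ord0 j - y ord0 j) by ring.
by rewrite (le_trans (ler_normB _ _))// mulr_natl mulr2n lerD.
Qed.

End coordinate_mean_value.

(** * The Euclidean norm *)

Section enorm.
Context {R : realType} {n : nat}.
Implicit Types x : 'rV[R]_n.

Lemma enorm_ge0 x : 0 <= enorm x.
Proof. exact: sqrtr_ge0. Qed.

Lemma ler_coord_enorm x (i : 'I_n) : `|x ord0 i| <= enorm x.
Proof.
rewrite -sqrtr_sqr ler_sqrt ?sumr_ge0//; last by move=> j _; exact: sqr_ge0.
by rewrite (bigD1 i)//= lerDl sumr_ge0// => j _; exact: sqr_ge0.
Qed.

Lemma sum_norm_enorm x : \sum_j `|x ord0 j| <= n%:R * enorm x.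
Proof.
rewrite (le_trans (ler_sum _ (fun j _ => ler_coord_enorm x j)))//.
by rewrite sumr_const card_ord mulr_natl.
Qed.

Lemma enorm_eq0 x : enorm x = 0 -> x = 0.
Proof.
move=> x0; apply/rowP => i; rewrite mxE; apply/eqP.
by rewrite -normr_eq0 eq_le normr_ge0 andbT -x0 ler_coord_enorm.
Qed.

Lemma enormN x : enorm (- x) = enorm x.
Proof. by congr Num.sqrt; apply: eq_bigr => i _; rewrite mxE sqrrN. Qed.

End enorm.

(** * Bounds by the Levy weight *)

Section Cb_bounds.
Context {R : realType} {n : nat}.
Implicit Types (u : 'rV[R]_n -> R) (x y : 'rV[R]_n).

Lemma Cb_measurable (k : nat) u : Cb k u -> measurable_fun setT u.
Proof. by case: k => [|k] [cu _ _]; exact: continuous_measurable_mx. Qed.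

Lemma Cb_bounded (k : nat) u :
  Cb k u -> exists2 M, 0 <= M & forall x, `|u x| <= M.
Proof. by case: k => [|k] [_ /bounded_fun_norm]. Qed.

Lemma Cb2_Cb1 u : Cb 2 u -> Cb 1 u.
Proof.
move=> [cu bu du]; split=> // i; have [di [ci bi _]] := du i.
by split=> //; split.
Qed.

Lemma Cb_increment_le (k : nat) u : Cb k u ->
  exists2 M, 0 <= M & forall y z, `|u y - u z| <= M.
Proof.
move=> /Cb_bounded[M M0 uM]; exists (M + M); first exact: addr_ge0.
by move=> y z; rewrite (le_trans (ler_normB _ _))// lerD.
Qed.

Lemma finite_family_bound (I : finType) (T : Type) (v : I -> T -> R) :
  (forall i, exists2 M, 0 <= M & forall t, `|v i t| <= M) ->
  exists2 M, 0 <= M & forall i t, `|v i t| <= M.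
Proof.
move=> h.
have /choice[M] : forall i, exists M, 0 <= M /\ forall t, `|v i t| <= M.
  by move=> i; have [M M0 vM] := h i; exists M.
move=> /all_and2[M0 vM]; exists (\sum_i M i); first exact: sumr_ge0.
by move=> i t; rewrite (le_trans (vM i t))// (bigD1 i)//= lerDl sumr_ge0.
Qed.

(** Merges a bound for large jumps with one for small jumps. *)
Lemma le_scaled_min1 (A B t : R) : 0 <= A -> 0 <= B -> 0 <= t ->
  forall C, A <= C -> B <= C ->
  forall r, r <= A -> r <= B * t -> r <= C * Num.min 1 t.
Proof.
move=> A0 B0 t0 C AC BC r rA rB; have C0 := le_trans A0 AC.
rewrite minr_pMr// mulr1 le_min (le_trans rA AC) (le_trans rB)//.
exact: ler_wpM2r.
Qed.

Lemma Cb1_increment_bound u : Cb 1 u ->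
  exists2 C, 0 <= C &
    forall y x, (u (y + x) - u y) ^+ 2 <= C * Num.min 1 (enorm x ^+ 2).
Proof.
move=> u1; have [M0 M00 uM0] := Cb_increment_le u1; have [_ _ du] := u1.
have [M M0' uM] : exists2 M, 0 <= M & forall i x, `|partial i u x| <= M.
  by apply: finite_family_bound => i; have [_ [_ /bounded_fun_norm]] := du i.
(* One bound serves large jumps and the other small ones; the sum of the two
   constants serves both. *)
exists (M0 ^+ 2 + (M * n%:R) ^+ 2); first by rewrite addr_ge0 ?sqr_ge0.
move=> y x; apply: (@le_scaled_min1 (M0 ^+ 2) ((M * n%:R) ^+ 2));
  rewrite ?lerDl ?lerDr ?sqr_ge0//.
- by rewrite -real_normK ?num_real// ler_sqr ?nnegrE.
- rewrite -exprMn -real_normK ?num_real//.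
  rewrite ler_sqr ?nnegrE ?mulr_ge0 ?enorm_ge0//.
  rewrite (le_trans (lipschitz_partial (fun i => (du i).1) uM _ _))//.
  rewrite -mulrA ler_wpM2l// (le_trans _ (sum_norm_enorm x))//.
  by apply: ler_sum => j _; rewrite mxE [y _ _ + _]addrC addrK.
Qed.

Lemma Cb2_second_difference_bound u : Cb 2 u ->
  exists2 C, 0 <= C & forall y x,
    `|u y - u (y + x) + (u y - u (y - x))| <= C * Num.min 1 (enorm x ^+ 2).
Proof.
move=> u2; have [M0 M00 uM0] := Cb_increment_le u2; have [_ _ du] := u2.
have [M M0' uM] : exists2 M, 0 <= M &
    forall (ij : 'I_n * 'I_n) x, `|partial ij.2 (partial ij.1 u) x| <= M.
  apply: finite_family_bound => -[i j] /=.
  by have [_ [_ _ /(_ j)[_ [_ /bounded_fun_norm]]]] := du i.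
exists (2 * M0 + 2 * M * n%:R ^+ 2); first by rewrite addr_ge0 ?mulr_ge0.
move=> y x; apply: (@le_scaled_min1 (2 * M0) (2 * M * n%:R ^+ 2));
  rewrite ?sqr_ge0 ?lerDl ?lerDr ?mulr_ge0//.
- by rewrite (le_trans (ler_normD _ _))// mulr_natl mulr2n lerD.
- rewrite (le_trans (@second_difference _ _ _ M _ _ _ _ _))//.
  + by move=> i z; have [] := du i.
  + by move=> i j z; have [_ [_ _ /(_ j)[]]] := du i.
  + by move=> i j z; exact: (uM (i, j)).
  + rewrite -[leRHS]mulrA -exprMn ler_wpM2l ?mulr_ge0//.
    rewrite ler_sqr ?nnegrE ?sumr_ge0 ?mulr_ge0 ?enorm_ge0//.
    exact: sum_norm_enorm.
Qed.

End Cb_bounds.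

(** * Invariance of the Lebesgue measure and of the measure on jumps *)

(** Change of variables without integrability: both sides are differences of the
    integrals of the same nonnegative parts. *)
Lemma integral_pushforwardT d1 d2 (X : measurableType d1)
    (Y : measurableType d2) (R : realType) (phi : X -> Y)
    (mphi : measurable_fun setT phi) (mu : {measure set X -> \bar R})
    (D : set Y) (f : Y -> \bar R) :
  measurable D -> measurable_fun setT f ->
  (\int[pushforward mu phi]_(y in D) f y =
   \int[mu]_(x in phi @^-1` D) f (phi x))%E.
Proof.
move=> mD mf; rewrite [LHS]integralE [RHS]integralE.
have mp := measurable_funTS (measurable_funepos mf) : measurable_fun D f^\+%E.
have mn := measurable_funTS (measurable_funeneg mf) : measurable_fun D f^\-%E.
rewrite (ge0_integral_pushforward mphi mu mD mp)//.
rewrite (ge0_integral_pushforward mphi mu mD mn)//.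
by rewrite -funepos_comp -funeneg_comp.
Qed.

Lemma lebesgue_measure_translation (R : realType) (a : R)
    (A : set (measurableTypeR R)) :
  measurable A -> lebesgue_measure ((fun x : R => x + a) @^-1` A) =
    lebesgue_measure A.
Proof.
have mt : measurable_fun setT
    ((fun x : R => x + a) : measurableTypeR R -> measurableTypeR R).
  exact: measurable_funD.
move=> mA; rewrite -[LHS]/(pushforward lebesgue_measure
  ((fun x : R => x + a) : measurableTypeR R -> measurableTypeR R) A).
apply/esym/lebesgue_measure_unique => //= _ [[b c]] _ <-.
rewrite /pushforward.
have -> : (fun x : R => x + a) @^-1` `]b, c] = `]b - a, c - a]%classic.
  by apply/seteqP; split=> x; rewrite /= !in_itv/= ltrBlDr lerBrDr.
by rewrite !lebesgue_measure_itv/= !lte_fin ltrD2r -!EFinB opprB addrA subrK.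
Qed.

Lemma cons_rVD (R : realType) (n : nat) (x : R) (w : 'rV[R]_n)
    (v : 'rV[R]_n.+1) :
  cons_rV (x, w) + v =
  cons_rV (x + v ord0 ord0, w + \row_i v ord0 (lift ord0 i)).
Proof.
apply/rowP => i; rewrite mxE; case: (unliftP ord0 i) => [j|] ->.
  by rewrite !cons_rVS !mxE.
by rewrite !cons_rV0.
Qed.

(** By induction on the dimension: the induction hypothesis translates the
    sections, and the one-dimensional case translates the first coordinate. *)
Lemma lebesgue_rV_translation (R : realType) (n : nat) (v : 'rV[R]_n)
    (A : set 'rV[R]_n) :
  measurable A ->
  lebesgue_rV R n ((fun y => y + v) @^-1` A) = lebesgue_rV R n A.
Proof.
elim: n v A => [|n IHn] v A mA.
  rewrite /= !diracE; congr (_%:R%:E).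
  by congr (nat_of_bool (_ \in _)); apply/seteqP; split=> y /=;
    rewrite (_ : y + v = y)//; apply/rowP => -[].
rewrite /= /lebesgue_cons /pushforward /product_measure1.
pose B := @cons_rV R n @^-1` A.
have mB : measurable B.
  by rewrite -[X in measurable X]setTI; exact: measurable_cons_rV.
pose F (x : measurableTypeR R) := lebesgue_rV R n (xsection B x).
have mF : measurable_fun setT F.
  exact: (measurable_fun_xsection (lebesgue_rV R n) mB).
have mt : measurable_fun setT
    ((fun x : R => x + v ord0 ord0) : measurableTypeR R -> measurableTypeR R).
  exact: measurable_funD.
transitivity (\int[@lebesgue_measure R]_x F (x + v ord0 ord0)%R)%E.
  apply: eq_integral => x _ /=.
  rewrite /F -(IHn (\row_i v ord0 (lift ord0 i))).
    2: exact: measurable_xsection.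
  congr (lebesgue_rV R n _); apply/seteqP; split=> w /=.
    by rewrite /xsection /= !inE /= cons_rVD.
  by rewrite /xsection /= !inE /= cons_rVD.
rewrite -[LHS](@ge0_integral_pushforward _ _ _ _ _ _ mt
  lebesgue_measure setT F)//.
apply: eq_measure_integral => C mC _; exact: lebesgue_measure_translation.
Qed.

Lemma measurable_rVD (R : realType) (n : nat) (d : measure_display)
    (T : measurableType d) (f g : T -> 'rV[R]_n) :
  measurable_fun setT f -> measurable_fun setT g ->
  measurable_fun setT (fun t => f t + g t).
Proof.
move=> mf mg; apply: measurable_fun_rV => i; under eq_fun do rewrite mxE.
by apply: measurable_funD; exact: (measurableT_comp (measurable_coord i)).
Qed.

Lemma measurable_rVN (R : realType) (n : nat) (d : measure_display)
    (T : measurableType d) (f : T -> 'rV[R]_n) :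
  measurable_fun setT f -> measurable_fun setT (fun t => - f t).
Proof.
move=> mf; apply: measurable_fun_rV => i; under eq_fun do rewrite mxE.
apply: measurableT_comp => //.
exact: (measurableT_comp (measurable_coord i)).
Qed.

Lemma measurable_enorm (R : realType) (n : nat) :
  measurable_fun setT (@enorm R n).
Proof.
apply: measurableT_comp.
  by apply: continuous_measurable_fun; exact: sqrt_continuous.
by apply: measurable_sum => i; apply: measurable_funX; exact: measurable_coord.
Qed.

Lemma measurable_eball0 (R : realType) (n : nat) (r : R) :
  measurable (@eball0 R n r).
Proof.
rewrite (_ : eball0 r = @enorm R n @^-1` `]-oo, r[%classic); last first.
  by apply/seteqP; split=> y; rewrite /eball0 /= in_itv.
by rewrite -[X in measurable X]setTI; exact: measurable_enorm.
Qed.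

Section symmetric_measure.
Context {R : realType} {n : nat} (nu : {measure set 'rV[R]_n -> \bar R}).
Hypothesis nu_sym : forall A : set 'rV[R]_n, measurable A ->
  nu [set - y | y in A] = nu A.

Lemma measurable_reflect : measurable_fun setT (fun y : 'rV[R]_n => - y).
Proof. exact: measurable_rVN. Qed.

Lemma symmetric_preimage (A : set 'rV[R]_n) : measurable A ->
  nu ((fun y => - y) @^-1` A) = nu A.
Proof.
move=> mA; rewrite -[RHS]nu_sym//; congr (nu _).
apply/seteqP; split=> [y Ay|_ [y Ay <-]]; last by rewrite /= opprK.
by exists (- y) => //; rewrite opprK.
Qed.

Lemma integral_reflect (f : 'rV[R]_n -> \bar R) (D : set 'rV[R]_n) :
  measurable D -> measurable_fun setT f ->
  (\int[nu]_(y in D) f y =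
   \int[nu]_(y in (fun y => (- y)%R) @^-1` D) f (- y)%R)%E.
Proof.
move=> mD mf.
transitivity (\int[pushforward nu (fun y => (- y)%R)]_(y in D) f y)%E;
  last by rewrite (integral_pushforwardT measurable_reflect).
apply: eq_measure_integral; first exact: measurable_reflect.
by move=> ? C mC _; apply/esym; exact: symmetric_preimage.
Qed.

End symmetric_measure.

Section flip.
Context {R : realType} {n : nat}.
Variable nu : {sigma_finite_measure set 'rV[R]_n -> \bar R}.
Hypothesis nu_sym : forall A : set 'rV[R]_n, measurable A ->
  nu [set - y | y in A] = nu A.

Local Notation P := (lebesgue_rV R n \x nu)%E.

(** A pair [(y, z)] stands for the jump from [y] to [y + z]; [flip] reverses the
    jump. *)
Definition flip (p : 'rV[R]_n * 'rV[R]_n) := (p.2 + p.1, - p.2).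

Lemma measurable_flip : measurable_fun setT flip.
Proof.
apply: measurable_fun_pair; first exact: measurable_rVD.
exact: measurable_rVN.
Qed.

(** [flip] is the reflection of [z], which for fixed [y] preserves [nu],
    composed with the shear [(y, z) |-> (y - z, z)], which for fixed [z] is a
    translation of [y]; the order of integration is exchanged in between. *)
Lemma flip_invariant (A : set ('rV[R]_n * 'rV[R]_n)) : measurable A ->
  P (flip @^-1` A) = P A.
Proof.
move=> mA.
have swap (B : set ('rV[R]_n * 'rV[R]_n)) : measurable B ->
    P B = (\int[nu]_z lebesgue_rV R n (ysection B z))%E.
  move=> mB; transitivity ((lebesgue_rV R n \x^ nu)%E B); last by [].
  apply: product_measure_unique => // C D mC mD /=.
  by rewrite product_measure2E.
pose S (p : 'rV[R]_n * 'rV[R]_n) := (p.1 - p.2, p.2).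
have mS : measurable_fun setT S.
  apply: measurable_fun_pair => //; apply: measurable_rVD => //.
  exact: measurable_rVN.
have mSA : measurable (S @^-1` A).
  by rewrite -[X in measurable X]setTI; exact: mS.
transitivity (P (S @^-1` A)).
  apply: eq_integral => y _ /=.
  rewrite -[RHS](symmetric_preimage nu_sym); last exact: measurable_xsection.
  congr (nu _); rewrite /xsection /flip /S; apply/seteqP; split=> z /=;
    by rewrite !inE /= opprK addrC.
rewrite swap// [RHS]swap//; apply: eq_integral => z _.
rewrite -[RHS](lebesgue_rV_translation (- z)); last exact: measurable_ysection.
by congr (lebesgue_rV R n _).
Qed.

Lemma integral_flip (F : 'rV[R]_n * 'rV[R]_n -> \bar R) :
  measurable_fun setT F -> (\int[P]_p F (flip p) = \int[P]_p F p)%E.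
Proof.
move=> mF.
transitivity (\int[pushforward P flip]_p F p)%E.
  by rewrite (integral_pushforwardT measurable_flip).
apply: eq_measure_integral; first exact: measurable_flip.
by move=> ? C mC _; exact: flip_invariant.
Qed.

Lemma integrable_flip (F : 'rV[R]_n * 'rV[R]_n -> \bar R) :
  P.-integrable setT F -> P.-integrable setT (F \o flip).
Proof.
move=> /integrableP[mF iF]; apply/integrableP; split.
  by apply: measurableT_comp => //; exact: measurable_flip.
have maF : measurable_fun setT (abse \o F) by exact: measurableT_comp.
by have /= -> := integral_flip maF.
Qed.

End flip.

(** * Finiteness properties *)

(** Monotonicity without measurability, immediate from the definition as a
    supremum over simple functions; it applies to inner integrals before
    their measurability in the parameter is established. *)
Lemma le_integral_nonneg d (T : measurableType d) (R : realType)
    (mu : {measure set T -> \bar R}) (D : set T) (f g : T -> \bar R) :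
  (forall x, D x -> (0 <= f x)%E) -> (forall x, D x -> (f x <= g x)%E) ->
  (\int[mu]_(x in D) f x <= \int[mu]_(x in D) g x)%E.
Proof.
move=> f0 fg; rewrite !ge0_integralE//; last first.
  by move=> x Dx; exact: le_trans (f0 x Dx) (fg x Dx).
apply: le_ereal_sup => _ [h hf <-]; exists h => // x.
apply: le_trans (hf x) _; rewrite !patchE; case: ifPn => // /set_mem; exact: fg.
Qed.

Lemma le_coord_mx_norm (R : realType) (n : nat) (x : 'rV[R]_n) (i : 'I_n) :
  `|x ord0 i| <= `|x|.
Proof.
rewrite -[leRHS]/(mx_norm x) mx_normrE.
exact: (le_bigmax _ (fun ij => `|x ij.1 ij.2|) (ord0, i)).
Qed.

Lemma lebesgue_rV_bounded (R : realType) (n : nat) (A : set 'rV[R]_n) :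
  measurable A -> bounded_set A -> (lebesgue_rV R n A < +oo)%E.
Proof.
move=> mA /pinfty_ex_gt0[M M0 AM].
pose b : 'rV[R]_n := const_mx M.
pose B := [set v : 'rV[R]_n | forall i, (- b) ord0 i <= v ord0 i <= b ord0 i].
have mB : measurable B.
  have -> : B = \bigcap_(i in [set: 'I_n])
      ((fun v : 'rV[R]_n => v ord0 i) @^-1` `[- b ord0 i, b ord0 i]).
    apply/seteqP; split=> v h i.
      by move=> _; have := h i; rewrite [(- b) _ _]mxE /= in_itv.
    by have := h i Logic.I; rewrite [(- b) _ _]mxE /= in_itv.
  apply: fin_bigcap_measurable => // i _.
  by rewrite -[X in measurable X]setTI; exact: measurable_coord.
have AB : A `<=` B.
  move=> v /AM vM i; rewrite !mxE -ler_norml.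
  exact: le_trans (le_coord_mx_norm v i) vM.
apply: (@le_lt_trans _ _ (lebesgue_rV R n B)).
  by apply: le_measure; rewrite ?inE.
rewrite lebesgue_rV_box ?ltry// => i; rewrite !mxE.
by rewrite (@le_trans _ _ 0)// ?oppr_le0 ltW.
Qed.

Section levy_measure.
Context {R : realType} {n : nat} {nu : {measure set 'rV[R]_n -> \bar R}}.
Hypothesis nu_levy : symmetric_levy_measure nu.

Let nu_sym := let: And3 _ s _ := nu_levy in s.

Lemma measurable_levy_weight :
  measurable_fun setT (fun z : 'rV[R]_n => Num.min 1 (enorm z ^+ 2)).
Proof.
apply: measurable_minr => //; apply: measurable_funX; exact: measurable_enorm.
Qed.

Lemma levy_weight_ge0 (z : 'rV[R]_n) : 0 <= Num.min 1 (enorm z ^+ 2).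
Proof. by rewrite le_min ler01 sqr_ge0. Qed.

(** Markov inequality: the weight is at least [min 1 (e ^ 2)] off the ball. *)
Lemma levy_tail_lty (e : R) : 0 < e -> (nu (~` eball0 e) < +oo)%E.
Proof.
move=> e0; have [_ _ I] := nu_levy.
have mE : measurable (~` @eball0 R n e).
  by apply: measurableC; exact: measurable_eball0.
pose c := Num.min 1 (e ^+ 2).
have c0 : 0 < c by rewrite lt_min ltr01 exprn_gt0.
suff : (c%:E * nu (~` eball0 e) < +oo)%E.
  by rewrite !ltey; apply: contra => /eqP ->; rewrite gt0_muley ?lte_fin.
apply: le_lt_trans I; rewrite -integral_cst//.
apply: (@le_trans _ _
  (\int[nu]_(y in ~` eball0 e) (Num.min 1 (enorm y ^+ 2))%:E)%E).
  apply: le_integral_nonneg; first by move=> y _; rewrite lee_fin ltW.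
  move=> y; rewrite /eball0 /= => /negP; rewrite -leNgt => ey.
  rewrite lee_fin /c le_min ge_min lexx /= ge_min.
  by rewrite ler_sqr ?nnegrE ?enorm_ge0 ?(ltW e0)// ey orbT.
apply: ge0_subset_integral => //.
- by apply/measurable_EFinP; exact: measurable_levy_weight.
- by move=> y _; rewrite lee_fin levy_weight_ge0.
Qed.

(** The origin, of measure zero, and the complements of the balls of radius
    [1 / (k + 1)] cover the space. *)
Lemma levy_sigma_finite : sigma_finite setT nu.
Proof.
have [nu0 _ _] := nu_levy.
pose Z : set 'rV[R]_n := @enorm R n @^-1` [set 0].
have mZ : measurable Z by rewrite -[Z]setTI; exact: measurable_enorm.
have nuZ : nu Z = 0%E.
  rewrite (_ : Z = [set 0])//; apply/seteqP; split=> z /=.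
    exact: enorm_eq0.
  move=> ->; rewrite /Z /= /enorm big1 ?sqrtr0// => i _.
  by rewrite mxE expr0n.
exists (fun k => Z `|` ~` eball0 k.+1%:R^-1).
  apply/esym; rewrite -subTset => z _.
  have [z0|z0] := eqVneq (enorm z) 0; first by exists 0%N => //; left.
  have zp : 0 < enorm z by rewrite lt_def z0 enorm_ge0.
  have [k _ /(_ k (leqnn k)) /= hk] := near_infty_natSinv_lt (PosNum zp).
  exists k => //; right; rewrite /eball0 /=; apply/negP; rewrite -leNgt.
  exact: ltW.
move=> k; have mE : measurable (~` @eball0 R n k.+1%:R^-1).
  by apply: measurableC; exact: measurable_eball0.
split; first exact: measurableU.
apply: (@le_lt_trans _ _ (nu Z + nu (~` eball0 k.+1%:R^-1))%E).
  exact: measureU2.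
by rewrite nuZ add0e levy_tail_lty// invr_gt0.
Qed.

Lemma integral_translate (y : 'rV[R]_n) (F : 'rV[R]_n -> \bar R) :
  measurable_fun setT F ->
  (\int[translate nu y]_x F x = \int[nu]_z F (z + y)%R)%E.
Proof.
by move=> mF; rewrite (integral_pushforwardT (measurable_addr_rV y)).
Qed.

Lemma Cb1_V_space (Omega : set 'rV[R]_n) (u : 'rV[R]_n -> R) :
  measurable Omega -> (lebesgue_rV R n Omega < +oo)%E -> Cb 1 u ->
  V_space nu Omega u.
Proof.
move=> mO Oy u1; have mu := Cb_measurable u1; split=> //.
have [_ _ I] := nu_levy.
apply: lte_add_pinfty.
  have [M M0 uM] := Cb_bounded u1.
  apply: (@le_lt_trans _ _ (\int[lebesgue_rV R n]_(x in Omega) (M ^+ 2)%:E)%E).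
    apply: le_integral_nonneg.
    - by move=> x _; rewrite lee_fin sqr_ge0.
    - move=> x _; rewrite lee_fin -real_normK ?num_real//.
      by rewrite ler_sqr ?nnegrE.
  by rewrite integral_cst// lte_mul_pinfty// lee_fin sqr_ge0.
have [C C0 uC] := Cb1_increment_bound u1.
apply: lte_mul_pinfty; rewrite ?lee_fin ?invr_ge0//.
pose J := (\int[nu]_z (Num.min 1 (enorm z ^+ 2))%:E)%E.
have J0 : (0 <= J)%E.
  by apply: integral_ge0 => z _; rewrite lee_fin levy_weight_ge0.
apply: (@le_lt_trans _ _ (\int[lebesgue_rV R n]_(y in Omega) (C%:E * J))%E).
  apply: le_integral_nonneg.
    by move=> y _; apply: integral_ge0 => z _; rewrite lee_fin sqr_ge0.
  move=> y _; rewrite integral_translate; last first.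
    apply/measurable_EFinP; apply: measurable_funX; exact: measurable_funB.
  rewrite -ge0_integralZl//; last 2 first.
    by apply/measurable_EFinP; exact: measurable_levy_weight.
    by move=> z _; rewrite lee_fin levy_weight_ge0.
  apply: le_integral_nonneg.
  - by move=> z _; rewrite lee_fin sqr_ge0.
  - by move=> z _; rewrite -EFinM lee_fin [z + y]addrC.
rewrite integral_cst// lte_mul_pinfty ?mule_ge0//.
by rewrite ge0_fin_numE ?mule_ge0// lte_mul_pinfty.
Qed.

Lemma integrable_levy_tail (h : 'rV[R]_n -> R) (M e : R) : 0 < e ->
  measurable_fun setT h -> (forall z, `|h z| <= M) ->
  nu.-integrable (~` eball0 e) (EFin \o h).
Proof.
move=> e0 mh hM; apply: measurable_bounded_integrable.
- by apply: measurableC; exact: measurable_eball0.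
- exact: levy_tail_lty.
- exact: measurable_funTS.
- exists M; split; first exact: num_real.
  by move=> r Mr z _ /=; rewrite (le_trans _ (ltW Mr)).
Qed.

(** The integrand of the truncated operator is only of first order in [z], which
    gives no bound uniform in [e]. Averaging it with its reflection replaces it
    by a second difference, bounded by a multiple of the Levy weight. *)
Lemma levy_truncated_bound (u : 'rV[R]_n -> R) : Cb 2 u ->
  exists2 C, 0 <= C & forall y e, 0 < e ->
    (`|levy_truncated nu u y e| <= C%:E)%E.
Proof.
move=> u2; have [_ _ I] := nu_levy; have mu := Cb_measurable u2.
have [C C0 uC] := Cb2_second_difference_bound u2.
pose J := (\int[nu]_z (Num.min 1 (enorm z ^+ 2))%:E)%E.
have J0 : (0 <= J)%E.
  by apply: integral_ge0 => z _; rewrite lee_fin levy_weight_ge0.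
have Jfin : J \is a fin_num by rewrite ge0_fin_numE.
exists (C * fine J); first by rewrite mulr_ge0// fine_ge0.
move=> y e e0.
have mE : measurable (~` @eball0 R n e).
  by apply: measurableC; exact: measurable_eball0.
have [M _ uM] := Cb_increment_le u2.
have mp : measurable_fun setT (fun z => u y - u (y + z)).
  apply: measurable_funB => //; apply: (measurableT_comp mu).
  exact: measurable_rVD.
have mn : measurable_fun setT (fun z : 'rV[R]_n => u y - u (y - z)).
  apply: measurable_funB => //; apply: (measurableT_comp mu).
  by apply: measurable_rVD => //; exact: measurable_rVN.
have mh : measurable_fun setT (fun z => (u y - u (y + z))%:E).
  exact/measurable_EFinP.
have iT := integrable_levy_tail e0 mp (fun z : 'rV[R]_n => uM y (y + z)).
have iT' := integrable_levy_tail e0 mn (fun z : 'rV[R]_n => uM y (y - z)).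
have symE : (fun z : 'rV[R]_n => - z) @^-1` (~` eball0 e) = ~` eball0 e.
  by apply/seteqP; split=> z; rewrite /eball0 /= enormN.
have refl := integral_reflect nu_sym mE mh; rewrite symE in refl.
have fT := integrable_fin_num mE iT.
set a := levy_truncated nu u y e.
have aa : (a + a = \int[nu]_(z in ~` eball0 e)
    (u y - u (y + z) + (u y - u (y - z)))%:E)%E.
  have := integralD mE iT iT'; rewrite /= => ->.
  by rewrite /a /levy_truncated {2}refl.
apply: (@le_trans _ _ `|a + a|%E).
  rewrite -[a]fineK// -EFinD !abse_EFin lee_fin -mulr2n normrMn mulr2n.
  by rewrite lerDl.
rewrite EFinM fineK// /J aa.
apply: (le_trans (le_abse_integral _ _ _)) => //.
  by apply/measurable_EFinP; apply: measurable_funTS; exact: measurable_funD.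
rewrite -ge0_integralZl//; last 2 first.
  by apply/measurable_EFinP; exact: measurable_levy_weight.
  by move=> z _; rewrite lee_fin levy_weight_ge0.
apply: (@le_trans _ _
  (\int[nu]_(z in ~` eball0 e) (C * Num.min 1 (enorm z ^+ 2))%:E)%E).
  by apply: le_integral_nonneg => // z _; rewrite lee_fin.
apply: ge0_subset_integral => //.
- apply/measurable_EFinP; apply: measurable_funM => //.
  exact: measurable_levy_weight.
- by move=> z _; rewrite lee_fin mulr_ge0 ?levy_weight_ge0.
Qed.

End levy_measure.

(** * Energy of a function over a set *)

Lemma ae_subset_integral d (T : measurableType d) (R : realType)
    (mu : {measure set T -> \bar R}) (A B : set T) (G : T -> \bar R) :
  measurable A -> measurable B -> measurable_fun setT G ->
  (forall x, (0 <= G x)%E) -> {ae mu, forall x, A x -> B x} ->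
  (\int[mu]_(x in A) G x <= \int[mu]_(x in B) G x)%E.
Proof.
move=> mA mB mG G0 AB; rewrite integral_mkcond [leRHS]integral_mkcond.
apply: ae_ge0_le_integral => //.
- by move=> x _; apply: erestrict_ge0.
- by apply/(measurable_restrictT _ mA); exact: measurable_funTS.
- by move=> x _; apply: erestrict_ge0.
- by apply/(measurable_restrictT _ mB); exact: measurable_funTS.
- apply: filterS AB => x AB _; rewrite !patchE.
  case: ifPn => [/set_mem/AB/mem_set -> //|_]; by case: ifPn.
Qed.

Lemma cvg_harmonic_right (R : realType) :
  (k.+1%:R^-1 : R) @[k --> \oo] --> (0 : R)^'+.
Proof.
move=> A hA; have hk : \forall k \near \oo,
    0 < k.+1%:R^-1 :> R -> A k.+1%:R^-1 := @cvg_harmonic R _ hA.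
by apply: filterS hk => k /=; apply; rewrite invr_gt0.
Qed.

Section energy.
Context {R : realType} {n : nat}.
Variable nu : {sigma_finite_measure set 'rV[R]_n -> \bar R}.

Implicit Types (w : 'rV[R]_n -> R) (y : 'rV[R]_n).

Local Notation lambda := (lebesgue_rV R n).
Local Notation P := (lebesgue_rV R n \x nu)%E.

Definition increment (w : 'rV[R]_n -> R) (p : 'rV[R]_n * 'rV[R]_n) : R :=
  w (p.2 + p.1) - w p.1.

Lemma measurable_shift (w : 'rV[R]_n -> R) : measurable_fun setT w ->
  measurable_fun setT (fun p : 'rV[R]_n * 'rV[R]_n => w (p.2 + p.1)).
Proof. by move=> mw; apply: (measurableT_comp mw); exact: measurable_rVD. Qed.

Lemma measurable_increment (w : 'rV[R]_n -> R) :
  measurable_fun setT w -> measurable_fun setT (increment w).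
Proof.
move=> mw; apply: measurable_funB; first exact: measurable_shift.
exact: (measurableT_comp mw).
Qed.

Lemma increment_flip w p : increment w (flip p) = - increment w p.
Proof. by rewrite /increment /flip /= addKr opprB. Qed.

Definition energy_density (w : 'rV[R]_n -> R) (y : 'rV[R]_n) : \bar R :=
  (\int[nu]_z (increment w (y, z) ^+ 2)%:E)%E.

Lemma measurable_energy_density w : measurable_fun setT w ->
  measurable_fun setT (energy_density w).
Proof.
move=> mw; apply: (@measurable_fun_fubini_tonelli_F _ _ _ _ _ nu
  (fun p => (increment w p ^+ 2)%:E)).
  apply/measurable_EFinP; apply: measurable_funX.
  exact: measurable_increment.
by move=> p; rewrite lee_fin sqr_ge0.
Qed.

Lemma energy_density_ge0 w y : (0 <= energy_density w y)%E.
Proof. by apply: integral_ge0 => z _; rewrite lee_fin sqr_ge0. Qed.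

Lemma translate_energy_density w y : measurable_fun setT w ->
  (\int[translate nu y]_x ((w x - w y) ^+ 2)%:E)%E = energy_density w y.
Proof.
move=> mw; rewrite integral_translate//.
by apply/measurable_EFinP; apply: measurable_funX; exact: measurable_funB.
Qed.

Lemma V_space_lty (Omega : set 'rV[R]_n) w : V_space nu Omega w ->
  (\int[lambda]_(x in Omega) (w x ^+ 2)%:E < +oo)%E /\
  (\int[lambda]_(y in Omega) energy_density w y < +oo)%E.
Proof.
move=> [mw].
under [in X in (_ + _ * X < _)%E]eq_integral do
  rewrite translate_energy_density//.
set a := (X in (X + _ < _)%E); set b := (X in (_ + _ * X < _)%E) => ab.
have a0 : (0 <= a)%E by apply: integral_ge0 => x _; rewrite lee_fin sqr_ge0.
have b0 : (0 <= b)%E by apply: integral_ge0 => x _; exact: energy_density_ge0.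
split.
  by apply: le_lt_trans ab; rewrite leeDl// mule_ge0// lee_fin invr_ge0.
rewrite -/b ltey; apply: contraTneq ab => ->.
rewrite gt0_muley ?lte_fin ?invr_gt0// addey ?ltxx//.
by rewrite gt_eqF// (lt_le_trans _ a0).
Qed.

(** For a test function, [E] is the set where it does not vanish, which lies in
    [Omega] only up to a null set. *)
Lemma integrable_localized_energy (Omega E : set 'rV[R]_n) w :
  measurable Omega -> measurable E -> {ae lambda, forall x, E x -> Omega x} ->
  V_space nu Omega w ->
  P.-integrable setT (fun p => (increment w p ^+ 2 * \1_E p.1)%:E).
Proof.
move=> mO mE EO Vw; have [mw _] := Vw; have [_ fw] := V_space_lty Vw.
apply/integrable12ltyP.
  apply/measurable_EFinP; apply: measurable_funM.
    by apply: measurable_funX; exact: measurable_increment.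
  by apply: (measurableT_comp (measurable_indic mE)).
apply: le_lt_trans fw; apply: le_trans (ae_subset_integral mE mO _ _ EO);
  [|exact: measurable_energy_density|exact: energy_density_ge0].
rewrite [leRHS]integral_mkcond; apply: le_integral_nonneg.
  by move=> y _; apply: integral_ge0 => z _; exact: abse_ge0.
move=> y _; rewrite patchE; case: ifPn => yE.
  apply: le_integral_nonneg => z _; first exact: abse_ge0.
  by rewrite /= indicE yE mulr1 ger0_norm ?sqr_ge0.
rewrite integral0_eq// => z _.
by rewrite /= indicE (negbTE yE) mulr0 normr0.
Qed.

End energy.

(** * Integration by parts for the bilinear form *)

Section weak_form.
Context {R : realType} {n : nat}.
Variable nu : {sigma_finite_measure set 'rV[R]_n -> \bar R}.
Hypothesis nu_levy : symmetric_levy_measure nu.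

Let nu_sym := let: And3 _ s _ := nu_levy in s.

Local Notation lambda := (lebesgue_rV R n).
Local Notation P := (lebesgue_rV R n \x nu)%E.

Variables (Omega : set 'rV[R]_n) (u phi : 'rV[R]_n -> R).
Hypothesis mOmega : measurable Omega.
Hypothesis Omega_lty : (lambda Omega < +oo)%E.
Hypothesis u_Cb2 : Cb 2 u.
Hypothesis phi_H : H_space nu Omega phi.

Let mu : measurable_fun setT u := Cb_measurable u_Cb2.
Let mphi : measurable_fun setT phi := phi_H.1.1.
Let supp : set 'rV[R]_n := [set x | phi x != 0].

Let msupp : measurable supp.
Proof.
have -> : supp = ~` (phi @^-1` [set 0]).
  by apply/seteqP; split=> x /=; [move=> /eqP|move=> /eqP].
by apply: measurableC; rewrite -[X in measurable X]setTI; exact: mphi.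
Qed.

Let phi_notin x : x \notin supp -> phi x = 0.
Proof. by apply: contraNeq => px; apply/mem_set. Qed.

Let supp_Omega : {ae lambda, forall x, supp x -> Omega x}.
Proof.
have [_] := phi_H; apply: filterS => x phi0 /eqP px.
by apply: contrapT => /phi0.
Qed.

(** [phi] vanishes almost everywhere off a set of finite measure, on which it is
    square integrable, and [|phi| <= phi ^ 2 + 1]. *)
Lemma integrable_test : lambda.-integrable setT (EFin \o phi).
Proof.
apply/integrableP; split; first exact/measurable_EFinP.
have [phi2 _] := V_space_lty phi_H.1.
have -> : (\int[lambda]_x `|(EFin \o phi) x| =
    \int[lambda]_(x in supp) `|(phi x)%:E|)%E.
  rewrite [RHS]integral_mkcond; apply: eq_integral => x _.
  by rewrite patchE /=; case: ifPn => // /phi_notin ->; rewrite normr0.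
apply: (@le_lt_trans _ _ (\int[lambda]_(x in Omega) (phi x ^+ 2 + 1)%:E)%E).
  apply: (le_trans (ae_subset_integral msupp mOmega _ _ supp_Omega)) => //.
    by apply/measurable_EFinP; apply: measurableT_comp.
  apply: le_integral_nonneg => x _ //=; rewrite lee_fin.
  rewrite -real_normK ?num_real//; have := sqr_ge0 (`|phi x| - 1); nra.
under eq_integral do rewrite EFinD.
rewrite ge0_integralD//.
- by rewrite integral_cst// mul1e lte_add_pinfty.
- by move=> x _; rewrite lee_fin sqr_ge0.
- by apply/measurable_EFinP; apply: measurable_funX; exact: measurable_funTS.
Qed.

Let form (p : 'rV[R]_n * 'rV[R]_n) : R := increment u p * increment phi p.

Let mform : measurable_fun setT form.
Proof. by apply: measurable_funM; exact: measurable_increment. Qed.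

(** The dominating function is [(D u) ^ 2 + (D phi) ^ 2] restricted to the jumps
    that start where [phi] does not vanish, plus its image under [flip], which
    takes care of the jumps that end there. *)
Lemma integrable_form : P.-integrable setT (EFin \o form).
Proof.
have Hu := integrable_localized_energy mOmega msupp supp_Omega
  (Cb1_V_space nu_levy mOmega Omega_lty (Cb2_Cb1 u_Cb2)).
have Hp := integrable_localized_energy mOmega msupp supp_Omega phi_H.1.
have H := integrableD measurableT Hu Hp.
have H' := integrable_flip nu_sym H.
apply: le_integrable (integrableD measurableT H H') => //.
  exact/measurable_EFinP.
move=> p _ /=; rewrite !increment_flip !sqrrN /= lee_fin.
rewrite -!mulrDl -mulrDr normrM normrM.
set s := increment u p ^+ 2 + increment phi p ^+ 2.
have s0 : 0 <= s by rewrite addr_ge0 ?sqr_ge0.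
have [pE|pE] := boolP ((p.1 \in supp) || (p.2 + p.1 \in supp)); last first.
  move: pE; rewrite negb_or => /andP[/phi_notin p1 /phi_notin p2].
  by rewrite [in `|increment phi p|]/increment p1 p2 subrr normr0 mulr0.
(* [phi] is nonzero at one of the two ends of the jump. *)
have : 1 <= \1_supp p.1 + \1_supp (p.2 + p.1) :> R.
  by rewrite !indicE; case/orP: pE => -> /=; rewrite ?lerDl ?lerDr ?ler0n.
set t := _ + _ => t1; have t0 : 0 <= t by apply: le_trans t1.
rewrite (ger0_norm s0) (ger0_norm t0).
apply: (@le_trans _ _ s); last by rewrite ler_peMr.
rewrite /s -(real_normK (num_real (increment u p))).
rewrite -(real_normK (num_real (increment phi p))).
have := sqr_ge0 (`|increment u p| - `|increment phi p|).
have := normr_ge0 (increment u p); have := normr_ge0 (increment phi p).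
nra.
Qed.

(** The jumps kept by the [k]-th truncation; [nu] is finite on them. *)
Let tail (k : nat) : set 'rV[R]_n := ~` eball0 k.+1%:R^-1.

Let mtail k : measurable (tail k).
Proof. by apply: measurableC; exact: measurable_eball0. Qed.

(** The part of the truncated form that carries [phi] at the start of the jump;
    its image under [flip] is the part that carries [phi] at the end. Without
    the truncation these two parts need not be integrable. *)
Let half k (p : 'rV[R]_n * 'rV[R]_n) : R :=
  - increment u p * phi p.1 * \1_(tail k) p.2.

Let mhalf k : measurable_fun setT (half k).
Proof.
apply: measurable_funM;
  last exact: (measurableT_comp (measurable_indic (mtail k))).
apply: measurable_funM; last exact: (measurableT_comp mphi).
by apply: measurableT_comp => //; exact: measurable_increment.
Qed.

Let integrable_half k : P.-integrable setT (EFin \o half k).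
Proof.
have [M M0 uM] := Cb_increment_le u_Cb2.
apply/integrable12ltyP; first exact/measurable_EFinP.
have ty : (nu (tail k) < +oo)%E by apply: levy_tail_lty => //; rewrite invr_gt0.
have tfin : nu (tail k) \is a fin_num by rewrite ge0_fin_numE.
apply: (@le_lt_trans _ _
  (\int[lambda]_y ((M * fine (nu (tail k)))%:E * `|(phi y)%:E|))%E).
  apply: le_integral_nonneg.
    by move=> y _; apply: integral_ge0 => z _; exact: abse_ge0.
  move=> y _; rewrite EFinM fineK// muleAC -integral_cst//.
  rewrite [leRHS]integral_mkcond; apply: le_integral_nonneg.
    by move=> z _; exact: abse_ge0.
  move=> z _; rewrite patchE /half /= indicE; case: ifPn => zt; last first.
    by rewrite mulr0 normr0.
  by rewrite mulr1 -EFinM lee_fin normrM normrN ler_wpM2r//; exact: uM.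
rewrite ge0_integralZl//.
- have /integrableP[_ fphi] := integrable_test.
  by apply: lte_mul_pinfty => //; rewrite lee_fin mulr_ge0 ?fine_ge0.
- by apply/measurable_EFinP; apply: measurableT_comp.
- by rewrite lee_fin mulr_ge0 ?fine_ge0.
Qed.

Let truncated_form_split k p :
  form p * \1_(tail k) p.2 = half k p + half k (flip p).
Proof.
rewrite /half increment_flip /flip /= !indicE.
have -> : (- p.2 \in tail k) = (p.2 \in tail k).
  by apply/idP/idP; rewrite !inE /tail /eball0 /= enormN.
rewrite /form [increment phi p]/increment; ring.
Qed.

Let integral_truncated_form k :
  (\int[P]_p (form p * \1_(tail k) p.2)%:E =
   2%:E * \int[P]_p (half k p)%:E)%E.
Proof.
under eq_integral do rewrite truncated_form_split EFinD.
rewrite (integralD measurableT (integrable_half k)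
  (integrable_flip nu_sym (integrable_half k))).
rewrite (integral_flip nu_sym (F := EFin \o half k));
  last exact/measurable_EFinP.
have := integrable_fin_num measurableT (integrable_half k).
by move=> /fineK <-; rewrite -EFinD -EFinM mulr_natl mulr2n.
Qed.

(** The inner integral of [half k]: the truncated operator tested against
    [phi]. *)
Let tested_levy k (y : 'rV[R]_n) : \bar R :=
  ((phi y)%:E * levy_truncated nu u y k.+1%:R^-1)%E.

Let tested_levy_fubini k : tested_levy k = fubini_F nu (EFin \o half k).
Proof.
apply/funext => y; rewrite /tested_levy /fubini_F /levy_truncated.
have [M _ uM] := Cb_increment_le u_Cb2.
have iT : nu.-integrable (tail k) (EFin \o (fun z => u y - u (y + z))).
  apply: (integrable_levy_tail nu_levy (M := M)) => //.
  apply: measurable_funB => //; apply: (measurableT_comp mu).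
  exact: measurable_rVD.
rewrite -(integralZl (mtail k) iT) [LHS]integral_mkcond.
apply: eq_integral => z _.
rewrite patchE /half /increment /= indicE [z + y]addrC; case: ifPn => _.
  by rewrite mulr1 opprB mulrC.
by rewrite mulr0.
Qed.

Let measurable_tested_levy k : measurable_fun setT (tested_levy k).
Proof.
rewrite tested_levy_fubini.
exact: (measurable_int _ (integrable_fubini_F (integrable_half k))).
Qed.

Let integral_half k :
  (\int[P]_p (half k p)%:E = \int[lambda]_(y in Omega) tested_levy k y)%E.
Proof.
rewrite -(integral12_prod_meas1 (integrable_half k)) -tested_levy_fubini.
rewrite [RHS]integral_mkcond; apply: ae_eq_integral => //.
  by apply/(measurable_restrictT _ mOmega); exact: measurable_funTS.
have [_] := phi_H; apply: filterS => y phi0 _; rewrite patchE.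
case: ifPn => // /negP; rewrite inE => /phi0 py.
by rewrite /tested_levy py mul0e.
Qed.

Let cvg_form :
  (\int[P]_p (form p * \1_(tail k) p.2)%:E)%E @[k --> \oo] -->
  (\int[P]_p (form p)%:E)%E.
Proof.
have mKk k : measurable_fun setT (fun p => (form p * \1_(tail k) p.2)%:E).
  apply/measurable_EFinP; apply: measurable_funM => //.
  exact: (measurableT_comp (measurable_indic (mtail k))).
have mKE : measurable_fun setT (EFin \o form) by exact/measurable_EFinP.
have iK := integrable_abse integrable_form.
have [] // := dominated_convergence measurableT mKk mKE _ iK _.
- apply: aeW => p _ /=.
  (* The jump 0 is never kept, but increments vanish on it; every other jump is
     kept from some rank on. *)
  have [p0|p0] := eqVneq (enorm p.2) 0.
    have form0 : form p = 0.
      by rewrite /form /increment (enorm_eq0 p0) add0r subrr mul0r.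
    by rewrite form0; under eq_fun do rewrite mul0r; exact: cvg_cst.
  apply: cvg_near_cst.
  have pp : 0 < enorm p.2 by rewrite lt_def p0 enorm_ge0.
  apply: filterS (near_infty_natSinv_lt (PosNum pp)) => k /= hk.
  rewrite indicE mem_set ?mulr1//.
  by rewrite /tail /eball0 /=; apply/negP; rewrite -leNgt ltW.
- apply: aeW => p k _ /=; rewrite lee_fin normrM ler_piMr// indicE.
  by rewrite ger0_norm ?lern1 ?leq_b1.
Qed.

Variable f : 'rV[R]_n -> R.
Hypothesis mf : measurable_fun Omega f.
Hypothesis Lu_f : {ae lambda, forall x, Omega x -> levy_op_eq nu u x (f x)}.

Let cvg_source :
  (\int[lambda]_(y in Omega) tested_levy k y)%E @[k --> \oo] -->
  (\int[lambda]_(y in Omega) (f y * phi y)%:E)%E.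
Proof.
have [C C0 LC] := levy_truncated_bound nu_levy u_Cb2.
have mF k : measurable_fun Omega (tested_levy k).
  by apply: measurable_funTS; exact: measurable_tested_levy.
have mg : measurable_fun Omega (fun y => (f y * phi y)%:E).
  apply/measurable_EFinP; apply: measurable_funM => //.
  exact: measurable_funTS.
have iC : lambda.-integrable Omega (fun y => C%:E * `|(phi y)%:E|)%E.
  apply: integrableZl => //; apply: (integrable_abse (f := EFin \o phi)).
  by apply: integrableS integrable_test.
have [] // := dominated_convergence mOmega mF mg _ iC _.
- apply: filterS Lu_f => y Luf /Luf [cL lL].
  have cvL : levy_truncated nu u y e @[e --> 0^'+] --> (f y)%:E by rewrite -lL.
  rewrite mulrC EFinM; apply: cvgeZl => //.
  exact: (@cvg_comp _ _ _ (fun k => k.+1%:R^-1) (levy_truncated nu u y) _ _ _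
    (@cvg_harmonic_right R) cvL).
- apply: aeW => y k _; rewrite /tested_levy abseM muleC lee_wpmul2r//.
  by apply: LC; rewrite invr_gt0.
Qed.

(** Both sides are the limit of the same sequence, the integrals over [Omega] of
    the truncated operators tested against [phi]. *)
Lemma form_source :
  ((2^-1)%:E * \int[P]_p (form p)%:E =
   \int[lambda]_(y in Omega) (f y * phi y)%:E)%E.
Proof.
have FE : (fun k => \int[lambda]_(y in Omega) tested_levy k y)%E =
    (fun k => (2^-1)%:E * \int[P]_p (form p * \1_(tail k) p.2)%:E)%E.
  apply/funext => k; rewrite integral_truncated_form integral_half muleA -EFinM.
  by rewrite mulVf ?mul1e// pnatr_eq0.
have half_fin : (2^-1)%:E \is a @fin_num R by [].
have := cvgeZl half_fin cvg_form; rewrite -FE => h.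
exact: cvg_unique (@ereal_hausdorff R) _ _ _ _ h cvg_source.
Qed.

End weak_form.

(** * Weak solutions *)

Lemma weak_solution_of_sigma_finite (R : realType) (n : nat)
    (nu : {sigma_finite_measure set 'rV[R]_n -> \bar R}) (Omega : set 'rV[R]_n)
    (f g u : 'rV[R]_n -> R) :
  symmetric_levy_measure nu -> measurable Omega ->
  (lebesgue_rV R n Omega < +oo)%E -> measurable_fun Omega f -> Cb 2 u ->
  ae_solution nu Omega f g u -> weak_solution nu Omega f g u.
Proof.
move=> nu_levy mO Oy mf u2 [Lu ug]; split=> //.
  exact: Cb1_V_space (Cb2_Cb1 u2).
move=> phi phiH; have mu := Cb_measurable u2; have mphi := phiH.1.1.
rewrite -(form_source nu_levy mO Oy u2 phiH mf Lu); congr (_ * _)%E.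
rewrite -(integral12_prod_meas1 (integrable_form nu_levy mO Oy u2 phiH)).
apply: eq_integral => y _; rewrite integral_translate//.
by apply/measurable_EFinP; apply: measurable_funM; exact: measurable_funB.
Qed.

(** A copy of [nu] that carries the proof of its sigma-finiteness, so that the
    theorems on product measures apply to it. *)
Definition sigma_finite_levy (R : realType) (n : nat)
    (nu : {measure set 'rV[R]_n -> \bar R})
    (nu_levy : symmetric_levy_measure nu) : set 'rV[R]_n -> \bar R := nu.

HB.instance Definition _ (R : realType) (n : nat)
    (nu : {measure set 'rV[R]_n -> \bar R})
    (nu_levy : symmetric_levy_measure nu) :=
  Measure.copy (sigma_finite_levy nu_levy) nu.

HB.instance Definition _ (R : realType) (n : nat)
    (nu : {measure set 'rV[R]_n -> \bar R})
    (nu_levy : symmetric_levy_measure nu) :=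
  Measure_isSigmaFinite.Build _ _ _ (sigma_finite_levy nu_levy)
    (levy_sigma_finite nu_levy).

Theorem theorem4p10 (R : realType) (n : nat)
    (nu : {measure set 'rV[R]_n -> \bar R}) (Omega : set 'rV[R]_n)
    (f g u : 'rV[R]_n -> R)
    (nu_levy : symmetric_levy_measure nu)
    (Omega_nonempty : Omega !=set0)
    (Omega_open : open Omega)
    (Omega_bounded : bounded_set Omega)
    (f_L2 : L2_on Omega f)
    (u_Cb2 : Cb 2 u)
    (u_solution : ae_solution nu Omega f g u) :
  weak_solution nu Omega f g u.
Proof.
have mO := open_measurable_mx Omega_open.
have Oy := lebesgue_rV_bounded mO Omega_bounded.
exact: (@weak_solution_of_sigma_finite R n (sigma_finite_levy nu_levy)
  Omega f g u nu_levy mO Oy f_L2.1 u_Cb2 u_solution).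
Qed.
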